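(* Let $F$ be a simple graph with $p=v(F)$ and $q=e(F)>1$, and let $B\subset B(\binom p2,F)$. If $f:\mathbb{N}\to\mathbb{N}$ is a nondecreasing function such that $\mathrm{gex}(B,n)<n\cdot f(n)$ for every $n\in\mathbb{N}$, then $$\mathrm{ex}_e(F,n)<q\cdot\mathrm{gex}(F,n)\cdot\mathrm{ex}_e(F,2f(n)+1)$$ for every $n\in\mathbb{N}$ with $n\ge 3$.
   Context: A hypergraph $H=(E_i: i\in I)$ is a finite list of finite nonempty subsets of $\mathbb{N}$ (edges; repetitions allowed); it is simple if its edges are pairwise distinct; a graph is a hypergraph all of whose edges have 2 elements. $v(H)=|\bigcup_i E_i|$, $e(H)=|I|$. $H$ contains $H'=(E'_i:i\in I')$, written $H\succ H'$, if there exist an increasing injection $\phi:\bigcup H'\to\bigcup H$ and an injection $f:I'\to I$ such that $v\in E'_i$ implies $\phi(v)\in E_{f(i)}$; an $H'$-copy in $H$ is the corresponding sub-configuration. $\mathrm{ex}_e(F,n)=\max\{e(H): H\not\succ F,\ H\text{ simple hypergraph},\ v(H)\le n\}$. For a family $R$ of simple graphs, $\mathrm{gex}(R,n)=\max\{e(G): G \text{ simple graph},\ v(G)\le n,\ G\not\succ G' \text{ for all } G'\in R\}$, and $\mathrm{gex}(G,n)=\mathrm{gex}(\{G\},n)$. For $k\in\mathbb{N}$, a simple graph $G'$ is a $k$-blow-up of a simple graph $G$ if for every edge colouring $\chi:G'\to\mathbb{N}$ using each colour at most $k$ times there is a $G$-copy in $G'$ on whose edges $\chi$ is injective; $B(k,G)$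 is the set of all $k$-blow-ups of $G$. *)

(* Defs.v *)
From HB Require Import structures.
From mathcomp Require Import all_boot finmap boolp classical_sets.

Set Implicit Arguments.
Unset Strict Implicit.
Unset Printing Implicit Defensive.

Local Open Scope fset_scope.
Local Open Scope classical_set_scope.

Record hypergraph := Hypergraph {
  edges : seq {fset nat};
  edges_nonempty : fset0 \notin edges
}.

Definition e (H : hypergraph) : nat := size (edges H).

Definition edge (H : hypergraph) (i : 'I_(e H)) : {fset nat} :=
  nth fset0 (edges H) i.

Definition vertices (H : hypergraph) : {fset nat} :=
  (\bigcup_(E <- edges H) E)%fset.

Definition v (H : hypergraph) : nat := #|` vertices H|.

Definition simple (H : hypergraph) : Prop := uniq (edges H).

Definition is_graph (H : hypergraph) : Prop :=
  forall i : 'I_(e H), #|` edge i| = 2.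

Definition simple_graph (H : hypergraph) : Prop := simple H /\ is_graph H.

(* [phi] stands for a map between vertex sets: only its values on
   [vertices H'] matter. *)
Definition is_copy (H H' : hypergraph) (phi : nat -> nat)
    (f : 'I_(e H') -> 'I_(e H)) : Prop :=
  [/\ forall x : nat, x \in vertices H' -> phi x \in vertices H,
      forall x y : nat, x \in vertices H' -> y \in vertices H' ->
        x < y -> phi x < phi y,
      injective f
    & forall (i : 'I_(e H')) (x : nat),
        x \in edge i -> phi x \in edge (f i)].

Definition contains (H H' : hypergraph) : Prop :=
  exists (phi : nat -> nat) (f : 'I_(e H') -> 'I_(e H)), is_copy phi f.

Definition is_max (A : set nat) (m : nat) : Prop :=
  A m /\ forall k : nat, A k -> k <= m.

(* Defaults to 0 when [A] has no maximum, i.e. is empty or unbounded. *)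
Definition max_of (A : set nat) : nat := xget 0 [set m | is_max A m].

Definition exe (F : hypergraph) (n : nat) : nat :=
  max_of [set m | exists H : hypergraph,
    [/\ simple H, v H <= n, ~ contains H F & e H = m]].

Definition gex (R : set hypergraph) (n : nat) : nat :=
  max_of [set m | exists G : hypergraph,
    [/\ simple_graph G, v G <= n,
        forall G', R G' -> ~ contains G G' & e G = m]].

(* Edges of a simple graph are in bijection with their indices, so edge
   colourings are taken on indices. *)
Definition blowup (k : nat) (G G' : hypergraph) : Prop :=
  simple_graph G' /\
  forall chi : 'I_(e G') -> nat,
    (forall c : nat, #|[pred i | chi i == c]| <= k) ->
    exists (phi : nat -> nat) (f : 'I_(e G) -> 'I_(e G')),
      is_copy phi f /\ injective (chi \o f).

Definition blowups (k : nat) (G : hypergraph) : set hypergraph :=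
  [set G' | blowup k G G'].

(* Main.v *)
Require Import Defs.
From mathcomp Require Import all_boot finmap boolp classical_sets.
From mathcomp Require Import zify.

(* Let [H] be an extremal hypergraph for [exe F n], [p := v F], and split its edges by size.

   Edges with at most [p] vertices: the graph of all pairs they contain avoids
   every graph of [B], because colouring each pair by an edge containing it uses
   each colour at most ['C(p, 2)] times and a rainbow copy of [F] would lift to [H].
   Hence this graph has a vertex of degree less than [2 f n]; the edges through
   that vertex form an [F]-free hypergraph on at most [2 f n + 1] vertices. Deleting
   vertices one by one gives at most [n * exe F (2 f n + 1)] such edges.

   Edges with more than [p] vertices: distinct pairs can be chosen from them
   greedily, and these form an [F]-free graph, so there are at most [gex F n].

   Finally [gex F n >= n - 1] and [exe F (2 f n + 1) >= 3], which makes the sum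
   smaller than [2 * gex F n * exe F (2 f n + 1)]. *)

Local Open Scope fset_scope.

(** * Extremal numbers as attained maxima *)

(** Nonemptiness and some bound, however crude, rule out the default value of [max_of]. *)
Lemma max_ofP (A : set nat) (k b : nat) :
  A k -> (forall m, A m -> m <= b) -> is_max A (max_of A).
Proof.
move=> Ak Ab; apply: (@xgetPex _ 0 [set m | is_max A m]%classic).
have exA : exists m, `[< A m >] by exists k; apply/asboolP.
have ubA m : `[< A m >] -> m <= b by move/asboolP/Ab.
case: (ex_maxnP exA ubA) => m /asboolP Am max_m; exists m; split=> // j Aj.
by apply: max_m; apply/asboolP.
Qed.

Lemma leq_max_of (A : set nat) (k b : nat) :
  A k -> (forall m, A m -> m <= b) -> k <= max_of A.
Proof. by move=> Ak /(max_ofP _ _ _ Ak) [_]; apply. Qed.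

Lemma sub_vertices (H : hypergraph) (E : {fset nat}) :
  E \in edges H -> E `<=` vertices H.
Proof. by move=> EH; apply/fsubsetP => x xE; apply/bigfcupP; exists E; rewrite ?EH. Qed.

Lemma leq_e_simple (H : hypergraph) (n : nat) : simple H -> v H <= n -> e H <= 2 ^ n.
Proof.
move=> sH vH; apply: (@leq_trans (2 ^ v H)); last by rewrite leq_exp2l.
rewrite -card_fpowerset; apply: uniq_leq_size => // E EH.
by rewrite fpowersetE sub_vertices.
Qed.

Lemma leq_gex (R : set hypergraph) (G : hypergraph) (n : nat) :
    simple_graph G -> v G <= n -> (forall G', R G' -> ~ contains G G') ->
  e G <= gex R n.
Proof.
move=> gG vG RG; apply: (@leq_max_of _ _ (2 ^ n)); first by exists G.
by move=> _ [G' [[sG' _] vG' _ <-]]; apply: leq_e_simple.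
Qed.

Lemma leq_exe (F H : hypergraph) (n : nat) :
  simple H -> v H <= n -> ~ contains H F -> e H <= exe F n.
Proof.
move=> sH vH HF; apply: (@leq_max_of _ _ (2 ^ n)); first by exists H.
by move=> _ [H' [sH' vH' _ <-]]; apply: leq_e_simple.
Qed.

(** * Containment on bare edge lists *)

(** Containment with plain indices and no nonemptiness proofs, so that lists can be filtered and
    extended freely. *)
Definition embeds (s t : seq {fset nat}) : Prop :=
  exists (phi f : nat -> nat),
  [/\ {in \bigcup_(E <- t) E &, {homo phi : x y / x < y}},
      forall i, i < size t -> f i < size s,
      forall i j, i < size t -> j < size t -> f i = f j -> i = j
    & forall i x, i < size t -> x \in nth fset0 t i -> phi x \in nth fset0 s (f i)].

(** The clause on vertices missing from [embeds] is automatic, since every vertex of [F] lies in an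
    edge. *)
Lemma containsE (H F : hypergraph) : contains H F <-> embeds (edges H) (edges F).
Proof.
split=> [[phi [f [_ homo_phi inj_f phi_f]]] | [phi [f [homo_phi ltf inj_f phi_f]]]].
  pose g i := oapp (fun i : 'I_(e F) => val (f i)) 0 (insub i).
  have gE (i : nat) (lti : i < e F) : g i = f (Ordinal lti) by rewrite /g insubT.
  exists phi, g; split=> [||i j lti ltj|i x lti xi].
  - by move=> x y xF yF; apply: homo_phi.
  - by move=> i lti; rewrite gE.
  - by rewrite !gE => /val_inj /inj_f [].
  - by rewrite gE; apply: (phi_f (Ordinal lti)).
pose g (i : 'I_(e F)) := Ordinal (ltf i (ltn_ord i)).
exists phi, g; split=> [x|x y|i j|i x].
- case/bigfcupP=> E; rewrite andbT => EF xE.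
  apply/bigfcupP; exists (nth fset0 (edges H) (f (index E (edges F)))).
    by rewrite andbT mem_nth // ltf // index_mem.
  by apply: phi_f; rewrite ?index_mem ?nth_index.
- exact: homo_phi.
- by case=> /inj_f eqij; apply/val_inj/eqij.
- exact: phi_f.
Qed.

(** A copy only asks that images of vertices lie in the chosen edges, so it survives their
    enlargement. *)
Lemma embeds_expand (s s' t : seq {fset nat}) (h : nat -> nat) :
    (forall i, i < size s -> h i < size s') ->
    (forall i j, i < size s -> j < size s -> h i = h j -> i = j) ->
    (forall i, i < size s -> nth fset0 s i `<=` nth fset0 s' (h i)) ->
  embeds s t -> embeds s' t.
Proof.
move=> lth inj_h sub_h [phi [f [homo_phi ltf inj_f phi_f]]].
exists phi, (h \o f); split=> // [i /ltf/lth //|i j lti ltj|i x lti xi] /=.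
  by move/inj_h => /(_ (ltf _ lti) (ltf _ ltj)); apply: inj_f.
by apply: (fsubsetP (sub_h _ (ltf _ lti))); apply: phi_f.
Qed.

Lemma embeds_sub (s s' t : seq {fset nat}) :
  uniq s -> {subset s <= s'} -> embeds s t -> embeds s' t.
Proof.
move=> us ss'; apply: (@embeds_expand _ _ _ (fun i => index (nth fset0 s i) s')).
- by move=> i lti; rewrite index_mem ss' ?mem_nth.
- move=> i j lti ltj eqij; apply/eqP; rewrite -(nth_uniq fset0 lti ltj us).
  by rewrite -(nth_index fset0 (ss' _ (mem_nth fset0 lti))) eqij nth_index ?ss' ?mem_nth.
- by move=> i lti; rewrite nth_index ?ss' ?mem_nth.
Qed.

(** * Increasing maps, cliques and choice of pairs *)

Lemma homo_ltn_inj (A : {fset nat}) (phi : nat -> nat) :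
  {in A &, {homo phi : x y / x < y}} -> {in A &, injective phi}.
Proof.
move=> homo_phi x y xA yA eqxy.
case: (ltngtP x y) => // ltxy.
  by have := homo_phi x y xA yA ltxy; rewrite eqxy ltnn.
by have := homo_phi y x yA xA ltxy; rewrite eqxy ltnn.
Qed.

(** Each element of [A] goes to the element of [B] of the same rank. *)
Lemma homo_ltn_fset (A B : {fset nat}) : #|` A| <= #|` B| ->
  exists2 phi : nat -> nat, {in A &, {homo phi : x y / x < y}}
    & {in A, forall x, phi x \in B}.
Proof.
move=> leAB.
have ltidx x : x \in A -> index x (sort leq A) < #|` A|.
  by move=> xA; rewrite -(size_sort leq) index_mem mem_sort.
exists (fun x => nth 0 (sort leq B) (index x (sort leq A))) => [x y xA yA ltxy|x xA].
  apply: (@sorted_ltn_nth _ ltn ltn_trans).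
  - by rewrite ltn_sorted_uniq_leq sort_uniq fset_uniq sort_sorted //; apply: leq_total.
  - by rewrite inE size_sort (leq_trans (ltidx _ xA)).
  - by rewrite inE size_sort (leq_trans (ltidx _ yA)).
  rewrite ltnNge; apply/negP => leyx; move: ltxy; rewrite ltnNge => /negP; apply.
  rewrite -[y](nth_index 0 (s := sort leq A)) ?mem_sort //.
  rewrite -[x](nth_index 0 (s := sort leq A)) ?mem_sort //.
  apply: (@sorted_leq_nth _ leq leq_trans leqnn) => //;
    rewrite ?inE ?index_mem ?mem_sort ?(nth_index, mem_sort) //.
  by apply: sort_sorted; apply: leq_total.
by rewrite -(mem_sort leq) mem_nth // size_sort (leq_trans (ltidx _ xA)).
Qed.

(** An increasing map of the vertices of [t] into [K] is injective, so distinct pairs of [t] have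
    distinct pairs of [K] as images. *)
Lemma embeds_clique (s t : seq {fset nat}) (K : {fset nat}) :
    uniq t -> {in t, forall E : {fset nat}, #|` E| = 2} ->
    #|` \bigcup_(E <- t) E| <= #|` K| ->
    (forall P, P `<=` K -> #|` P| = 2 -> P \in s) ->
  embeds s t.
Proof.
move=> ut t2 /homo_ltn_fset [phi homo_phi phiK] Ks.
have inj_phi := homo_ltn_inj _ _ homo_phi.
have subt i : i < size t -> {subset nth fset0 t i <= \bigcup_(E <- t) E}.
  by move=> lti x xi; apply/bigfcupP; exists (nth fset0 t i); rewrite ?mem_nth.
pose im i := [fset phi x | x in nth fset0 t i].
have ims i : i < size t -> im i \in s.
  move=> lti; apply: Ks.
    by apply/fsubsetP=> _ /imfsetP[x /= xi ->]; apply: phiK; apply: (subt i lti).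
  rewrite card_in_imfset /= ?(t2 _ (mem_nth fset0 lti)) //.
  by move=> x y xi yi; apply: inj_phi; apply: (subt i).
exists phi, (fun i => index (im i) s); split=> //.
- by move=> i lti; rewrite index_mem ims.
- move=> i j lti ltj eqij; apply/eqP; rewrite -(nth_uniq fset0 lti ltj ut).
  have {}eqij : im i = im j by rewrite -(nth_index fset0 (ims i lti)) eqij nth_index ?ims.
  have half a b : a < size t -> b < size t -> im a = im b ->
    nth fset0 t a `<=` nth fset0 t b.
    move=> lta ltb eqab; apply/fsubsetP => x xa.
    have : phi x \in im a by apply: in_imfset.
    rewrite eqab => /imfsetP[y /= yb /inj_phi ->] //; [exact: subt xa|exact: subt yb].
  by rewrite eqEfsubset !half.
- by move=> i x lti xi; rewrite nth_index ?ims //; apply: in_imfset.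
Qed.

(* A large edge always offers an unused pair, for otherwise it would be a clique of the
   graph of pairs chosen so far. *)
Lemma distinct_pairs (s t : seq {fset nat}) :
    uniq t -> {in t, forall E : {fset nat}, #|` E| = 2} ->
    {in s, forall E : {fset nat}, #|` \bigcup_(E <- t) E| <= #|` E|} ->
    ~ embeds s t ->
  exists r : seq {fset nat}, [/\ uniq r, size r = size s
    & forall i, i < size s -> nth fset0 r i `<=` nth fset0 s i /\ #|` nth fset0 r i| = 2].
Proof.
move=> ut t2; elim: s => [_ _|E s IHs large nemb]; first by exists [::].
have nembs : ~ embeds s t.
  by move=> emb; apply: nemb; apply: (embeds_expand s (E :: s) t succn) emb => // i j _ _ [].
have [|r [ur szr rs]] := IHs _ nembs.
  by move=> E' E's; apply: large; rewrite inE E's orbT.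
have [P [PE P2 Pr]] : exists P, [/\ P `<=` E, #|` P| = 2 & P \notin r].
  apply: contrapT => noP; apply: nembs.
  apply: (embeds_expand r s t id) => [i|//|i|]; first by rewrite szr.
    by rewrite szr => /rs[].
  apply: (embeds_clique r t E) => // [|P PE P2]; first by apply: large; rewrite mem_head.
  by apply/negPn/negP => Pr; apply: noP; exists P.
exists (P :: r); split=> /=; [by rewrite Pr|by rewrite szr|].
by case=> [|i] //= /rs.
Qed.

(** * The graph of covered pairs and blow-ups *)

Lemma size_pairs_leq (E : {fset nat}) (s : seq {fset nat}) :
    uniq s -> {in s, forall P : {fset nat}, P `<=` E /\ #|` P| = 2} ->
  size s <= 'C(#|` E|, 2).
Proof.
(* [g] carries subsets of [E] to the finite type of its elements, where [cards_draws] counts the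
   pairs. *)
move=> us sE; pose g (P : {fset nat}) := [set x : E | val x \in P]%SET.
have gK P : P `<=` E -> [fset val x | x in g P] = P.
  move=> PE; apply/fsetP => x; apply/imfsetP/idP => [[y /= + ->]|xP].
    by rewrite inE.
  by exists [` fsubsetP PE _ xP] => //=; rewrite inE.
have -> : 'C(#|` E|, 2) = #|[set A : {set E} | A \subset [set: E]%SET & #|A| == 2]%SET|.
  by rewrite cards_draws cardsT -cardfE.
rewrite -(size_map g) cardE; apply: uniq_leq_size.
  rewrite map_inj_in_uniq // => P Q /sE [PE _] /sE [QE _] eqPQ.
  by rewrite -(gK P) // eqPQ gK.
move=> _ /mapP[P /sE [PE P2] ->]; rewrite mem_enum inE finset.subsetT /=.
rewrite -P2 -{2}(gK _ PE) card_imfset /=; last exact: val_inj.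
by rewrite cardE.
Qed.

(** The 2-section of [s]; filtering a powerset lists each pair once, however many edges cover it. *)
Definition shadow (s : seq {fset nat}) : seq {fset nat} :=
  [seq P : {fset nat} <- fpowerset (\bigcup_(E <- s) E)
    | (#|` P| == 2) && has (fun E => P `<=` E) s].

Lemma mem_shadow (s : seq {fset nat}) (P : {fset nat}) :
  (P \in shadow s) = (#|` P| == 2) && has (fun E => P `<=` E) s.
Proof.
rewrite mem_filter fpowersetE andb_idr // => /andP[_ /hasP[E Es PE]].
apply/fsubsetP => x xP; apply/bigfcupP; exists E; rewrite ?Es //.
exact: (fsubsetP PE).
Qed.

Lemma fset0_notin_graph (s : seq {fset nat}) :
  {in s, forall P : {fset nat}, #|` P| = 2} -> fset0 \notin s.
Proof. by move=> s2; apply/negP => /s2; rewrite cardfs0. Qed.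

Lemma simple_graph_edges (s : seq {fset nat}) (s0 : fset0 \notin s) :
    uniq s -> {in s, forall P : {fset nat}, #|` P| = 2} ->
  simple_graph (Hypergraph s0).
Proof. by move=> us s2; split=> // i; apply: s2; rewrite mem_nth. Qed.

Lemma edges_card2 (G : hypergraph) :
  is_graph G -> {in edges G, forall P : {fset nat}, #|` P| = 2}.
Proof.
move=> gG P PG; have ltP : index P (edges G) < e G by rewrite index_mem.
by have := gG (Ordinal ltP); rewrite /edge nth_index.
Qed.

(** The colour of an edge of [G'] is the index of the first edge of [H] covering its image. A colour
    class thus lies inside one edge of [H], and a rainbow copy of [F] uses distinct edges of [H]. *)
Lemma shadow_blowup_free (F H G G' : hypergraph) (p : nat) :
    simple G -> edges G = shadow (edges H) ->
    {in edges H, forall E : {fset nat}, #|` E| <= p} ->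
    ~ contains H F -> blowup 'C(p, 2) F G' ->
  ~ contains G G'.
Proof.
move=> sG GE small nHF [[sG' gG'] bG'] [psi [g [_ homo_psi inj_g psi_g]]].
pose chi (i : 'I_(e G')) := find (fun E => edge (g i) `<=` E) (edges H).
have edgeG i : (edge (g i) \in edges G) by rewrite mem_nth.
have hasG i : has (fun E => edge (g i) `<=` E) (edges H).
  by have := edgeG i; rewrite GE mem_shadow => /andP[].
have inj_edge : injective (fun i => edge (g i)).
  move=> i j /eqP; rewrite /edge nth_uniq //; first by move/eqP/val_inj/inj_g.
have [|phi [f [[_ homo_phi inj_f phi_f] inj_chi]]] := bG' chi.
  move=> c; rewrite cardE -(size_map (fun i => edge (g i))).
  apply: (@leq_trans 'C(#|` nth fset0 (edges H) c|, 2)).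
    apply: size_pairs_leq; first by rewrite map_inj_uniq // enum_uniq.
    move=> _ /mapP[i + ->]; rewrite mem_enum inE => /eqP <-; split.
      exact: (nth_find fset0 (hasG i)).
    by apply/eqP; have := edgeG i; rewrite GE mem_shadow => /andP[].
  (* A colour that is no edge index yields the default [fset0], which obeys the bound too. *)
  apply: leq_bin2l; case: (ltnP c (size (edges H))) => [ltc|gec].
    by apply: small; rewrite mem_nth.
  by rewrite nth_default ?cardfs0.
apply: nHF.
have ltchi i : chi i < e H by rewrite /chi -has_find.
have in_edge (K : hypergraph) (i : 'I_(e K)) x : x \in edge i -> x \in vertices K.
  by move=> xi; apply: (fsubsetP (sub_vertices K _ (mem_nth fset0 (ltn_ord i)))).
have phiV x : x \in vertices F -> phi x \in vertices G'.
  case/bigfcupP=> E; rewrite andbT => EF xE.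
  have ltE : index E (edges F) < e F by rewrite index_mem.
  apply: (in_edge _ (f (Ordinal ltE))); apply: phi_f.
  by rewrite /edge nth_index.
have cpy i x : x \in edge i -> psi (phi x) \in edge (Ordinal (ltchi (f i))).
  move=> xi; apply: (fsubsetP (nth_find fset0 (hasG (f i)))).
  exact/psi_g/phi_f.
exists (psi \o phi), (fun i => Ordinal (ltchi (f i))); split=> //.
- move=> x /bigfcupP[E]; rewrite andbT => EF xE.
  have ltE : index E (edges F) < e F by rewrite index_mem.
  apply: (in_edge _ (Ordinal (ltchi (f (Ordinal ltE))))); apply: cpy.
  by rewrite /edge nth_index.
- move=> x y xF yF ltxy; apply: homo_psi; try exact: phiV.
  exact: homo_phi.
- by move=> i j [] eqij; apply: inj_chi.
Qed.

(** * Small edges: deleting vertices of low degree *)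

(** Double counting of incidences: each pair has at most two vertices in [V], so the degrees over
    [V] sum to at most [2 * size s]. *)
Lemma exists_low_degree (V : {fset nat}) (s : seq {fset nat}) (d : nat) :
    {in s, forall P : {fset nat}, #|` P| = 2} -> size s < #|` V| * d ->
  exists2 x, x \in V & count (fun P : {fset nat} => x \in P) s < 2 * d.
Proof.
move=> s2 lts; apply: contrapT => high.
have {}high x : x \in V -> 2 * d <= count (fun P : {fset nat} => x \in P) s.
  by move=> xV; rewrite leqNgt; apply/negP => lt; apply: high; exists x.
have : \sum_(x <- V) 2 * d <= \sum_(x <- V) \sum_(P <- s) (x \in P : nat).
  rewrite big_seq [leqRHS]big_seq; apply: leq_sum => x xV; apply: (leq_trans (high x xV)).
  by rewrite -sum1_count big_mkcond leq_sum // => P _; case: (_ \in _).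
rewrite exchange_big /= => /leq_trans /(_ _) le.
have /le : \sum_(P <- s) \sum_(x <- V) (x \in P : nat) <= \sum_(P <- s) 2.
  rewrite big_seq [leqRHS]big_seq; apply: leq_sum => P Ps.
  rewrite -big_mkcond /= sum1_count -size_filter -(s2 P Ps).
  apply: uniq_leq_size => [|x]; first by rewrite filter_uniq ?fset_uniq.
  by rewrite mem_filter => /andP[].
rewrite !big_const_seq !count_predT !iter_addn_0.
by move: lts; set a := size V; set b := size s; nia.
Qed.

Lemma size_small_edges (F : hypergraph) (B : set hypergraph) (f : nat -> nat) (n : nat) :
    (B `<=` blowups 'C(v F, 2) F)%classic ->
    (forall m n : nat, 0 < m -> m <= n -> f m <= f n) ->
    (forall n : nat, 0 < n -> gex B n < n * f n) ->
  forall (m : nat) (s : seq {fset nat}),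
    m <= n -> uniq s -> fset0 \notin s ->
    {in s, forall E : {fset nat}, #|` E| <= v F} ->
    ~ embeds s (edges F) -> #|` \bigcup_(E <- s) E| <= m ->
  size s <= m * exe F (2 * f n + 1).
Proof.
move=> hB hmono hgex; elim=> [|m IHm] s lemn us s0 small nemb ltVm.
  case: s s0 ltVm {us small nemb} => //= E s s0.
  rewrite leqn0 cardfs_eq0 big_cons fsetU_eq0 => /andP[/eqP E0 _].
  by rewrite E0 mem_head in s0.
set V := \bigcup_(E <- s) E in ltVm *; set X := exe _ _.
(* With at most [m] vertices the induction hypothesis applies to [s] itself; otherwise [V] has
   exactly [m.+1], as the degree average needs. *)
case: (leqP #|` V| m) => [leVm|ltmV].
  by apply: leq_trans (IHm s (ltnW lemn) us s0 small nemb leVm) _; rewrite leq_mul.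
have {ltVm}cardV : #|` V| = m.+1 by apply/eqP; rewrite eqn_leq ltVm.
have sh2 : {in shadow s, forall P : {fset nat}, #|` P| = 2}.
  by move=> P; rewrite mem_shadow => /andP[/eqP].
have ush : uniq (shadow s) by rewrite filter_uniq ?fset_uniq.
have sh0 := fset0_notin_graph _ sh2.
pose G := Hypergraph sh0.
have vG : v G <= m.+1.
  rewrite -cardV fsubset_leq_card //; apply/bigfcupsP => P.
  by rewrite mem_filter fpowersetE => /andP[_].
have ltG : size (shadow s) < #|` V| * f n.
  rewrite cardV; apply: (@leq_trans (m.+1 * f m.+1)); last by rewrite leq_mul // hmono.
  apply: leq_ltn_trans (hgex m.+1 isT); apply: (leq_gex _ G) => //.
    exact: simple_graph_edges.
  move=> G' /hB bG'; apply: (shadow_blowup_free F (Hypergraph s0) G G' (v F)) => //.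
  by move/containsE.
have [x0 x0V ltdeg] := exists_low_degree _ _ _ sh2 ltG.
pose s1 := [seq E : {fset nat} <- s | x0 \in E].
pose s2 := [seq E : {fset nat} <- s | x0 \notin E].
have sub1 : {subset s1 <= s} by move=> E; rewrite mem_filter => /andP[].
have sub2 : {subset s2 <= s} by move=> E; rewrite mem_filter => /andP[].
have us1 : uniq s1 by rewrite filter_uniq.
have us2 : uniq s2 by rewrite filter_uniq.
have -> : size s = (size s1 + size s2)%N by rewrite !size_filter count_predC.
rewrite mulSn leq_add //.
  have s10 : fset0 \notin s1 by apply: contra s0; apply: sub1.
  apply: (leq_exe _ (Hypergraph s10)) => //; last first.
    by move/containsE; apply: contra_not nemb; apply: embeds_sub.
  (* Mapping [x] to the pair of [x0] and [x] injects [W] without [x0] into the shadow pairs through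
     [x0]; the vertex [x0] itself accounts for the [+ 1]. *)
  set W := \bigcup_(E <- s1) E.
  rewrite /v /vertices /= -/W (cardfsD1 x0) addnC leq_add ?leq_b1 //.
  apply: (leq_trans _ (ltnW ltdeg)); rewrite -size_filter.
  rewrite -(size_map (fun x => [fset x0; x])); apply: uniq_leq_size.
    rewrite map_inj_in_uniq // => x y; rewrite !in_fsetD1 => /andP[xx0 _] _ eqxy.
    have : x \in [fset x0; y] by rewrite -eqxy !inE eqxx orbT.
    by rewrite !inE (negPf xx0) => /eqP.
  move=> _ /mapP[x + ->]; rewrite in_fsetD1 => /andP[xx0 /bigfcupP[E]].
  rewrite andbT mem_filter => /andP[x0E Es] xE.
  rewrite mem_filter !inE eqxx mem_shadow cardfs2 eq_sym xx0 /=.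
  by apply/hasP; exists E => //; apply/fsubsetP => y; rewrite !inE => /orP[] /eqP ->.
apply: IHm => //; first exact: ltnW.
- by apply: contra s0; apply: sub2.
- by move=> E /sub2; apply: small.
- by apply: contra_not nemb; apply: embeds_sub.
(* The edges avoiding [x0] span a subset of [V] without [x0], hence at most [m] vertices. *)
rewrite -ltnS -cardV (cardfsD1 x0 V) x0V ltnS; apply: fsubset_leq_card.
apply/fsubsetP => x /bigfcupP[E]; rewrite andbT mem_filter => /andP[x0E Es] xE.
rewrite in_fsetD1; apply/andP; split; first by apply: contraNneq x0E => <-.
by apply/bigfcupP; exists E; rewrite ?Es.
Qed.

(** * Lower bounds from stars and singletons *)

Lemma pair_ltn (E : {fset nat}) : #|` E| = 2 -> exists a b, a < b /\ E = [fset a; b].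
Proof.
move=> E2; have /fset0Pn[x xE] : E != fset0 by rewrite -cardfs_gt0 E2.
move: E2; rewrite (cardfsD1 x) xE => -[] /eqP /cardfs1P [y Ey].
have : y \in E `\ x by rewrite Ey inE.
rewrite in_fsetD1 => /andP[yx _].
rewrite -(fsetD1K xE) Ey; case: (ltngtP x y) => ltxy.
- by exists x, y.
- by exists y, x; rewrite fsetUC.
- by rewrite ltxy eqxx in yx.
Qed.

(* An [F] embedding into both the star centred at the first vertex and the one centred at
   the last would have edges sharing both their minimum and their maximum. *)
Lemma gex_star (F : hypergraph) (n : nat) :
  simple_graph F -> 1 < e F -> 0 < n -> n.-1 <= gex [set F]%classic n.
Proof.
move=> [sF gF] qF n0.
have F2 := edges_card2 _ gF.
(* Used with centre [0] and leaves from [1] to [n.-1], and with centre [n.-1] and leaves below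
   it. *)
pose star (c a : nat) := [seq [fset c; i] | i <- iota a n.-1].
have star2 c a : c \notin iota a n.-1 -> {in star c a, forall P : {fset nat}, #|` P| = 2}.
  move=> ca _ /mapP[i ia ->]; rewrite cardfs2.
  by case: eqVneq ia ca => // -> ->.
have star_uniq c a : c \notin iota a n.-1 -> uniq (star c a).
  move=> ca; rewrite map_inj_in_uniq ?iota_uniq // => i j ia _ eqij.
  have : i \in [fset c; j] by rewrite -eqij !inE eqxx orbT.
  by rewrite !inE => /orP[] /eqP // ic; rewrite -ic ia in ca.
have star_free c a : c \notin iota a n.-1 -> ~ embeds (star c a) (edges F) ->
    n.-1 <= gex [set F]%classic n.
  move=> ca nemb.
  have s0 := fset0_notin_graph _ (star2 c a ca).
  apply: (@leq_trans (e (Hypergraph s0))); first by rewrite /e size_map size_iota.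
  apply: leq_gex; first by apply: simple_graph_edges; [exact: star_uniq|exact: star2].
    apply: (@leq_trans (size (c :: iota a n.-1))); last by rewrite /= size_iota prednK.
    apply: uniq_leq_size => // x /bigfcupP[P]; rewrite andbT => /mapP[i ia ->].
    by rewrite !inE => /orP[] /eqP ->; rewrite ?eqxx ?ia ?orbT.
  by move=> _ -> /containsE.
have [emb0|] := pselect (embeds (star 0 1) (edges F)); last first.
  by apply: star_free; rewrite mem_iota.
apply: (star_free n.-1 0); first by rewrite mem_iota ltnn.
case=> [psi [g [homo_psi ltg _ psi_g]]].
case: emb0 => [phi [f [homo_phi ltf _ phi_f]]].
have nth_star c a i : i < size (star c a) ->
    exists2 j, j \in iota a n.-1 & nth fset0 (star c a) i = [fset c; j].
  by move=> lti; have /mapP[j ja ->] := mem_nth fset0 lti; exists j.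
(* The centre is the smaller end of each edge in the first star and the larger end in the second;
   increasing maps respect this. *)
have lo i x y : i < e F -> x \in nth fset0 (edges F) i -> y \in nth fset0 (edges F) i ->
    x < y -> phi x = 0 /\ psi y = n.-1.
  move=> lti xi yi ltxy.
  have iV : nth fset0 (edges F) i `<=` vertices F by rewrite sub_vertices ?mem_nth.
  have xV := fsubsetP iV x xi; have yV := fsubsetP iV y yi.
  split.
    have := homo_phi x y xV yV ltxy.
    have := phi_f i x lti xi; have := phi_f i y lti yi.
    have [j _ ->] := nth_star _ _ _ (ltf i lti).
    by rewrite !inE; lia.
  have := homo_psi x y xV yV ltxy.
  have := psi_g i x lti xi; have := psi_g i y lti yi.
  have [j + ->] := nth_star _ _ _ (ltg i lti).
  by rewrite mem_iota !inE; lia.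
have split_edge i : i < e F -> exists x y, [/\ x < y, x \in vertices F, y \in vertices F
    & nth fset0 (edges F) i = [fset x; y]].
  move=> lti; have iF := mem_nth fset0 lti.
  have iV := sub_vertices _ _ iF.
  have /pair_ltn [x [y [ltxy eqE]]] := F2 _ iF.
  exists x, y; split=> //; apply: (fsubsetP iV); by rewrite eqE !inE eqxx ?orbT.
have [x0 [y0 [lt0 x0V y0V E0]]] := split_edge 0 (ltnW qF).
have [x1 [y1 [lt1 x1V y1V E1]]] := split_edge 1 qF.
have [phi0 psi0] : phi x0 = 0 /\ psi y0 = n.-1.
  by apply: (lo 0); rewrite ?(ltnW qF) // E0 !inE eqxx ?orbT.
have [phi1 psi1] : phi x1 = 0 /\ psi y1 = n.-1.
  by apply: (lo 1); rewrite // E1 !inE eqxx ?orbT.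
have x01 : x0 = x1 by apply: (homo_ltn_inj _ _ homo_phi); rewrite ?phi0.
have y01 : y0 = y1 by apply: (homo_ltn_inj _ _ homo_psi); rewrite ?psi0.
have : nth fset0 (edges F) 0 == nth fset0 (edges F) 1 by rewrite E0 E1 x01 y01.
by rewrite nth_uniq // (ltnW qF).
Qed.

(** A family of singletons avoids [F]: an increasing map cannot send both ends of an edge into one
    singleton. *)
Lemma exe_singletons (F : hypergraph) (n : nat) :
  is_graph F -> 0 < e F -> n <= exe F n.
Proof.
move=> gF qF; pose s := [seq [fset i] | i <- iota 0 n].
have s0 : fset0 \notin s.
  by apply/negP => /mapP[i _ /fsetP /(_ i)]; rewrite !inE eqxx.
apply: (@leq_trans (e (Hypergraph s0))); first by rewrite /e size_map size_iota.
apply: leq_exe.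
- by rewrite /simple /= map_inj_uniq ?iota_uniq //; apply: fset1_inj.
- apply: (@leq_trans (size (iota 0 n))); last by rewrite size_iota.
  apply: uniq_leq_size => // x /bigfcupP[P]; rewrite andbT => /mapP[i ia ->].
  by rewrite inE => /eqP ->.
case/containsE=> phi [f [homo_phi ltf _ phi_f]].
have [x [y [ltxy eqE]]] := pair_ltn _ (edges_card2 _ gF _ (mem_nth fset0 qF)).
have xE : x \in nth fset0 (edges F) 0 by rewrite eqE !inE eqxx.
have yE : y \in nth fset0 (edges F) 0 by rewrite eqE !inE eqxx orbT.
have EV := sub_vertices _ _ (mem_nth fset0 qF).
have := homo_phi x y (fsubsetP EV x xE) (fsubsetP EV y yE) ltxy.
have := phi_f 0 x qF xE; have := phi_f 0 y qF yE.
have /mapP[i _ ->] := mem_nth fset0 (ltf 0 qF).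
by rewrite !inE; lia.
Qed.

(** * Large edges *)

(** A copy of [F] among the pairs chosen by [distinct_pairs] would expand to one in the edges they
    come from. *)
Lemma size_large_edges (F H : hypergraph) (n : nat) (s : seq {fset nat}) :
    simple_graph F -> v H <= n -> ~ contains H F ->
    uniq s -> {subset s <= edges H} ->
    {in s, forall E : {fset nat}, v F <= #|` E|} ->
  size s <= gex [set F]%classic n.
Proof.
move=> [sF gF] vH nHF us sH large.
have nembs : ~ embeds s (edges F).
  by apply: contra_not nHF => emb; apply/containsE; apply: embeds_sub emb.
have [r [ur szr rs]] := distinct_pairs _ _ sF (edges_card2 _ gF) large nembs.
have rP P : P \in r -> exists2 i, i < size s & P = nth fset0 r i.
  by move=> Pr; exists (index P r); rewrite ?nth_index // -szr index_mem.
have r2 : {in r, forall P : {fset nat}, #|` P| = 2} by move=> _ /rP[i /rs[] _ + ->].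
have r0 := fset0_notin_graph _ r2.
rewrite -szr; apply: (leq_gex _ (Hypergraph r0)).
- exact: simple_graph_edges.
- apply: leq_trans vH; apply: fsubset_leq_card; apply/bigfcupsP => _ /rP[i lti ->] _.
  by apply: (fsubset_trans (proj1 (rs i lti))); rewrite sub_vertices ?sH ?mem_nth.
move=> _ -> /containsE; apply: contra_not nembs.
apply: (embeds_expand _ _ _ id) => //= i; rewrite szr // => /rs[] //.
Qed.

(** * Combining the bounds *)

Local Open Scope classical_set_scope.

Theorem theorem2 (F : hypergraph) (B : set hypergraph) (f : nat -> nat)
  (hF : simple_graph F)
  (hq : 1 < e F)
  (hB : B `<=` blowups 'C(v F, 2) F)
  (hmono : forall m n : nat, 0 < m -> m <= n -> f m <= f n)
  (hgex : forall n : nat, 0 < n -> gex B n < n * f n) :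
  forall n : nat, 3 <= n ->
    exe F n < e F * gex [set F] n * exe F (2 * f n + 1).
Proof.
move=> n n3; have [sF gF] := hF.
have [H [sH vH nHF eH]] : exists H, [/\ simple H, v H <= n, ~ contains H F & e H = exe F n].
  have [] // := @max_ofP [set m | exists H, [/\ simple H, v H <= n, ~ contains H F & e H = m]]
    0 (2 ^ n).
    (* The empty hypergraph shows that the maximum is taken over a nonempty set, as [F] has an
       edge. *)
    exists (@Hypergraph [::] isT); split=> //; first by rewrite /v /vertices big_nil.
    by case/containsE=> phi [g [_ /(_ 0 (ltnW hq))]].
  by move=> _ [H [sH vH _ <-]]; apply: leq_e_simple.
pose small := [seq E : {fset nat} <- edges H | #|` E| <= v F].
pose large := [seq E : {fset nat} <- edges H | ~~ (#|` E| <= v F)].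
have sub_small : {subset small <= edges H} by move=> E; rewrite mem_filter => /andP[].
set g := gex _ n; set X := exe F (_ + _).
have le_small : size small <= n * X.
  apply: (size_small_edges F B f n) => //.
  - by rewrite filter_uniq.
  - by apply: contra (edges_nonempty H); apply: sub_small.
  - by move=> E; rewrite mem_filter => /andP[].
  - apply: contra_not nHF => emb; apply/containsE; apply: embeds_sub emb => //.
    by rewrite filter_uniq.
  - apply: leq_trans vH; apply: fsubset_leq_card; apply/bigfcupsP => E ES _.
    by rewrite sub_vertices ?sub_small.
have le_large : size large <= g.
  apply: (size_large_edges F H) => //; first by rewrite filter_uniq.
  - by move=> E; rewrite mem_filter => /andP[].
  - by move=> E; rewrite mem_filter -ltnNge => /andP[/ltnW].
have g_ge : n.-1 <= g by apply: gex_star => //; apply: ltnW; apply: ltnW.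
(* The strict bound on [gex B n] forces [f n] to be positive, whence [2 * f n + 1 >= 3]. *)
have f_gt0 : 0 < f n by have := hgex n (ltnW (ltnW n3)); case: (f n) => //; rewrite muln0.
have X_ge : 3 <= X by apply: leq_trans (exe_singletons F _ gF (ltnW hq)); lia.
rewrite -eH /e -(count_predC (fun E : {fset nat} => #|` E| <= v F)) -!size_filter.
apply: (leq_ltn_trans (leq_add le_small le_large)).
have le1 : n * X <= X + g * X by rewrite -mulSn leq_mul //; lia.
have le2 : g * X + g * X <= e F * g * X by rewrite addnn -mul2n -mulnA leq_mul.
(* The difference is [(g - 1) * (X - 1) - 1], positive since [g >= 2], which uses [n >= 3], and
   [X >= 3]. *)
have lt3 : X + g < g * X by have : 2 <= g by [lia]; move: X_ge; clear; nia.
apply: (leq_ltn_trans (leq_add le1 (leqnn g))); apply: leq_trans le2.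
by rewrite addnAC ltn_add2r.
Qed.
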